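(* Let $p$ be a prime number. Assume that $R$ is a Noetherian normal domain of characteristic $p>0$ and let $B$ be a perfect integrally closed $\mathbf{F}_p$-domain that is an $R$-algebra which is torsion free and integral over $R$. Then the ring of Witt vectors $\mathbf{W}(B)$ is an integrally closed domain.
   Context: All rings are commutative with unity; $B$ is not assumed Noetherian. An $\mathbf{F}_p$-algebra $B$ is perfect if the Frobenius map $b\mapsto b^p$ on $B$ is bijective. $\mathbf{W}(B)$ denotes the ring of $p$-typical Witt vectors of $B$. A domain is integrally closed if it is integrally closed in its field of fractions. *)

(* Defs.v *)
From HB Require Import structures.
From mathcomp Require Import all_boot all_order all_algebra.
From mathcomp Require Import finmap boolp.
From mathcomp.multinomials Require Import monalg.

Set Implicit Arguments.
Unset Strict Implicit.
Unset Printing Implicit Defensive.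

Import GRing.Theory Num.Theory.
Local Open Scope ring_scope.

Section Noetherian.
Variable R : comNzRingType.

Definition ideal_of (I : R -> Prop) : Prop :=
  [/\ I 0, forall x y, I x -> I y -> I (x + y) & forall a x, I x -> I (a * x)].

Definition noetherian : Prop :=
  forall I : R -> Prop, ideal_of I ->
  exists n (g : 'I_n -> R), forall x,
    I x <-> exists c : 'I_n -> R, x = \sum_(i < n) c i * g i.

End Noetherian.

Definition integrally_closed (D : idomainType) : Prop :=
  forall u : {fraction D}, integralOver (@tofrac D) u -> exists a : D, u = tofrac a.

(** [domain_of dom] is the ring [A] regarded as an [idomainType]. *)
Definition domain_of (A : comUnitRingType)
  (dom : GRing.integral_domain_axiom A) : Type := A.
HB.instance Definition _ A dom := GRing.ComUnitRing.on (@domain_of A dom).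
HB.instance Definition _ A dom :=
  GRing.ComUnitRing_isIntegral.Build (@domain_of A dom) dom.

Definition integrally_closed_domain (A : comUnitRingType) : Prop :=
  exists dom : GRing.integral_domain_axiom A,
    integrally_closed (domain_of dom).

Definition perfect (p : nat) (B : pzSemiRingType) : Prop :=
  bijective (fun b : B => b ^+ p).

Definition torsion_free (R B : idomainType) (f : {rmorphism R -> B}) : Prop :=
  forall r b, f r * b = 0 -> r = 0 \/ b = 0.

Notation ipoly I := {malg int[{cmonom I}]}.

Section IPoly.
Variable I : choiceType.

Definition ivar (i : I) : ipoly I := << ucm i >>.

(** Euclidean division of all coefficients; it is only ever used when exact, see
    [ipdivK]. *)
Definition ipdiv (f : ipoly I) (d : nat) : ipoly I :=
  [malg k in msupp f => (f@_k %/ d%:Z)%Z].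

Section Eval.
Variables (A : comNzRingType) (x : I -> A).

Definition meval (m : {cmonom I}) : A := \prod_(i <- finsupp m) x i ^+ m i.

Lemma mevalEw (d : {fset I}) (m : {cmonom I}) :
  (finsupp m `<=` d)%fset -> meval m = \prod_(i <- d) x i ^+ m i.
Proof.
move=> sd; rewrite /meval [in LHS](big_fset_incl _ sd) // => i _ ni.
by move: ni; rewrite -cmE_eq0 => /eqP->.
Qed.

Lemma meval_mmorphism : mmorphism meval.
Proof.
split=> [m1 m2|]; last by rewrite /meval mdom1 big_seq_fset0.
pose d := (finsupp m1 `|` finsupp m2)%fset.
rewrite (@mevalEw d) ?mdomD // (@mevalEw d m1) ?fsubsetUl //.
rewrite (@mevalEw d m2) ?fsubsetUr // -big_split /=.
by apply: eq_bigr => i _; rewrite cmM exprD.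
Qed.
HB.instance Definition _ :=
  isMultiplicative.Build {cmonom I} A meval meval_mmorphism.

Definition ipeval (f : ipoly I) : A := mmap (intr : int -> A) meval f.
HB.instance Definition _ :=
  GRing.RMorphism.copy ipeval (mmap (intr : int -> A) meval).

Lemma ipeval_var i : ipeval (ivar i) = x i.
Proof. by rewrite /ipeval mmapU /= mul1r /meval mdomU big_seq_fset1 cmUU. Qed.

End Eval.
End IPoly.

Definition ghost (p : nat) (A : pzSemiRingType) (x : nat -> A) (n : nat) : A :=
  \sum_(i < n.+1) x i ^+ (p ^ (n - i)) *+ p ^ i.

Lemma rmorph_ghost p (A B : comNzRingType) (f : {rmorphism A -> B}) x n :
  f (ghost p x n) = ghost p (fun i => f (x i)) n.
Proof. by rewrite rmorph_sum; apply: eq_bigr => i _; rewrite rmorphMn rmorphXn. Qed.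

Lemma eq_ghost p (A : pzSemiRingType) (x y : nat -> A) :
  x =1 y -> ghost p x =1 ghost p y.
Proof. by move=> exy n; apply: eq_bigr => i _; rewrite exy. Qed.

Lemma ghostS p (A : pzSemiRingType) (x : nat -> A) n :
  ghost p x n.+1 = ghost p (fun i => x i ^+ p) n + x n.+1 *+ p ^ n.+1.
Proof.
rewrite [LHS]big_ord_recr /= subnn expn0 expr1; congr (_ + _).
apply: eq_bigr => i _; have le_in : (i <= n)%N by rewrite -ltnS.
by rewrite subSn // expnS exprM.
Qed.

Section Unghost.
Variables (p : nat) (I : choiceType) (g : nat -> ipoly I).

Fixpoint unghost_seq (n : nat) : seq (ipoly I) :=
  if n is m.+1 then
    let s := unghost_seq m in
    rcons s (ipdiv (g m - \sum_(i < m) s`_i ^+ (p ^ (m - i)) *+ p ^ i) (p ^ m))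
  else [::].

(** The family of integer polynomials with ghost components [g] (when there is
    one), solved for recursively; see [unghostE] and [ghost_unghost]. *)
Definition unghost (n : nat) : ipoly I := (unghost_seq n.+1)`_n.

Lemma size_unghost_seq n : size (unghost_seq n) = n.
Proof. by elim: n => //= n IHn; rewrite size_rcons IHn. Qed.

Lemma nth_unghost_seq n i : (i < n)%N -> (unghost_seq n)`_i = unghost i.
Proof.
elim: n => // n IHn; rewrite ltnS leq_eqVlt => /predU1P[->//|lt_in].
by rewrite [unghost_seq _]/= nth_rcons size_unghost_seq lt_in IHn.
Qed.

Lemma unghostE n :
  unghost n =
  ipdiv (g n - \sum_(i < n) unghost i ^+ (p ^ (n - i)) *+ p ^ i) (p ^ n).
Proof.
have -> : \sum_(i < n) unghost i ^+ (p ^ (n - i)) *+ p ^ i =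
          \sum_(i < n) (unghost_seq n)`_i ^+ (p ^ (n - i)) *+ p ^ i.
  by apply: eq_bigr => i _; rewrite nth_unghost_seq.
by rewrite /unghost [unghost_seq n.+1]/= nth_rcons size_unghost_seq ltnn eqxx.
Qed.

End Unghost.

Section Congruence.
Variable A : comNzRingType.

Definition eqmodn (d : nat) (a b : A) : Prop := exists c, a = b + c *+ d.

Lemma eqmodn_refl d a : eqmodn d a a.
Proof. by exists 0; rewrite mul0rn addr0. Qed.

Lemma eqmodn_sym d a b : eqmodn d a b -> eqmodn d b a.
Proof. by case=> c ->; exists (- c); rewrite mulNrn addrK. Qed.

Lemma eqmodn_trans d a b c : eqmodn d a b -> eqmodn d b c -> eqmodn d a c.
Proof.
by move=> [u ->] [v ->]; exists (v + u); rewrite mulrnDl addrA.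
Qed.

Lemma eqmodnD d a b a' b' :
  eqmodn d a b -> eqmodn d a' b' -> eqmodn d (a + a') (b + b').
Proof.
by move=> [u ->] [v ->]; exists (u + v); rewrite mulrnDl addrACA.
Qed.

Lemma eqmodnN d a b : eqmodn d a b -> eqmodn d (- a) (- b).
Proof. by move=> [u ->]; exists (- u); rewrite mulNrn opprD. Qed.

Lemma eqmodnM d a b a' b' :
  eqmodn d a b -> eqmodn d a' b' -> eqmodn d (a * a') (b * b').
Proof.
move=> [u ->] [v ->]; exists (u * b' + (b + u *+ d) * v).
by rewrite mulrDr [X in X + _]mulrDl mulrnAl mulrnAr -addrA -mulrnDl.
Qed.

Lemma eqmodnX d a b n : eqmodn d a b -> eqmodn d (a ^+ n) (b ^+ n).
Proof.
move=> h; elim: n => [|n IHn]; first exact: eqmodn_refl.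
by rewrite !exprS; apply: eqmodnM.
Qed.

Lemma eqmodn_sum d n (a b : 'I_n -> A) :
  (forall i, eqmodn d (a i) (b i)) -> eqmodn d (\sum_i a i) (\sum_i b i).
Proof.
move=> h; elim/big_ind2: _ => [|????|//]; first exact: eqmodn_refl.
exact: eqmodnD.
Qed.

Lemma eqmodnMn d k a b : eqmodn d a b -> eqmodn (d * k) (a *+ k) (b *+ k).
Proof. by move=> [u ->]; exists u; rewrite mulrnDl mulrnA. Qed.

Lemma eqmodnW d k a b : eqmodn (d * k) a b -> eqmodn d a b.
Proof. by move=> [u ->]; exists (u *+ k); rewrite -mulrnA mulnC. Qed.

Lemma eqmodn_pX (p : nat) (a b : A) k :
  eqmodn (p ^ k.+1) a b -> eqmodn (p ^ k.+2) (a ^+ p) (b ^+ p).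
Proof.
move=> h; have [u def_a] := h.
have hp : eqmodn p a b by apply: (@eqmodnW _ (p ^ k)); rewrite -expnS.
have [v def_v] : eqmodn p (\sum_(i < p) a ^+ (p.-1 - i) * b ^+ i) 0.
  have /eqmodn_trans: eqmodn p (\sum_(i < p) a ^+ (p.-1 - i) * b ^+ i)
     (\sum_(i < p) b ^+ p.-1).
    apply: eqmodn_sum => i.
    rewrite -[in b ^+ p.-1](@subnK i p.-1); last first.
      by case: p i {h def_a hp} => [[]//|p] i /=; rewrite -ltnS.
    rewrite exprD; apply: eqmodnM; last exact: eqmodn_refl.
    exact: eqmodnX.
  apply; exists (b ^+ p.-1).
  by rewrite add0r sumr_const card_ord.
exists (u * v); apply/eqP; rewrite addrC -subr_eq subrXX def_v add0r.
by rewrite {1}def_a addrAC subrr add0r mulrnAl mulrnAr -mulrnA -expnS.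
Qed.

Lemma eqmodn_pXn (p : nat) (a b : A) k :
  eqmodn p a b -> eqmodn (p ^ k.+1) (a ^+ (p ^ k)) (b ^+ (p ^ k)).
Proof.
move=> h; elim: k => [|k IHk]; first by rewrite expn0 expn1 !expr1.
by rewrite [in X in a ^+ X]expnSr [in X in b ^+ X]expnSr !exprM;
   apply: eqmodn_pX.
Qed.

Lemma eqmodn_pD (p : nat) (a b : A) :
  prime p -> eqmodn p ((a + b) ^+ p) (a ^+ p + b ^+ p).
Proof.
case: p => // q p_pr.
rewrite exprDn big_ord_recr big_ord_recl /= subnn subn0 !expr0 mul1r mulr1.
rewrite bin0 binn !mulr1n addrAC.
exists (\sum_(i < q) (a ^+ (q.+1 - i.+1) * b ^+ i.+1) *+ ('C(q.+1, i.+1) %/ q.+1)).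
congr (_ + _); rewrite -sumrMnl; apply: eq_bigr => i _.
by rewrite -mulrnA divnK // prime_dvd_bin //= ltnS.
Qed.

End Congruence.

Section Dwork.
Variables (p : nat) (p_pr : prime p) (I : choiceType).

Lemma ipoly_mulrn_inj (d : nat) :
  (0 < d)%N -> injective (fun f : ipoly I => f *+ d).
Proof.
move=> d_gt0 f g fg; apply/malgP => k.
have /eqP: f@_k *+ d = g@_k *+ d by rewrite -!mcoeffMn fg.
by rewrite -subr_eq0 -mulrnBl mulrn_eq0 gtn_eqF //= subr_eq0 => /eqP.
Qed.

Lemma ipdivK (f : ipoly I) d : (0 < d)%N -> eqmodn d f 0 -> ipdiv f d *+ d = f.
Proof.
move=> d_gt0 [h def_f]; apply/malgP => k; rewrite mcoeffMn mcoeffE.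
case: ifPn => [_|/mcoeff_outdom -> //]; last by rewrite mul0rn.
have E (x : int) : x *+ d = x * d by rewrite -mulr_natr natz.
by rewrite def_f add0r mcoeffMn !E mulzK // -lt0n.
Qed.

(** The ring endomorphism raising every variable to the power [p]. *)
Let mfrob (m : {cmonom I}) : ipoly I := << m >> ^+ p.

Let mfrob_mmorphism : mmorphism mfrob.
Proof.
split=> [m1 m2|]; last by rewrite /mfrob -[<< _ >>]/(1 : ipoly I) expr1n.
by rewrite /mfrob -exprMn malgM_def fgmulUU mulr1.
Qed.
HB.instance Definition _ :=
  isMultiplicative.Build {cmonom I} (ipoly I) mfrob mfrob_mmorphism.

Definition ipfrob : ipoly I -> ipoly I := mmap (intr : int -> ipoly I) mfrob.
HB.instance Definition _ :=
  GRing.RMorphism.copy ipfrob (mmap (intr : int -> ipoly I) mfrob).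

Lemma ipfrob_var i : ipfrob (ivar i) = ivar i ^+ p.
Proof. by rewrite /ipfrob mmapU /= mul1r. Qed.

Lemma ipfrobP (f : ipoly I) : eqmodn p (ipfrob f) (f ^+ p).
Proof.
pose S (f : ipoly I) := eqmodn p (ipfrob f) (f ^+ p).
have S0 : S 0.
  rewrite /S rmorph0 expr0n (gtn_eqF (prime_gt0 p_pr)).
  exact: eqmodn_refl.
have SD a b : S a -> S b -> S (a + b).
  move=> Sa Sb; rewrite /S rmorphD.
  exact: eqmodn_trans (eqmodnD Sa Sb) (eqmodn_sym (eqmodn_pD _ _ p_pr)).
have SN a : S a -> S (- a).
  move=> Sa; have Sa' := eqmodn_pD a (- a) p_pr.
  rewrite subrr expr0n (gtn_eqF (prime_gt0 p_pr)) in Sa'.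
  rewrite /S rmorphN; apply: (eqmodn_trans (eqmodnN Sa)).
  have := eqmodnD (eqmodn_refl p (- a ^+ p)) Sa'.
  by rewrite addr0 addKr.
have SMn a n : S a -> S (a *+ n).
  move=> Sa; elim: n => [|n IHn]; first by rewrite mulr0n; exact: S0.
  by rewrite mulrS; exact: SD.
have S1 k : S << k >>.
  by rewrite /S /ipfrob mmapU /= mul1r; apply: eqmodn_refl.
have SU (c : int) k : S << c *g k >>.
  have SUn n : S << n%:Z *g k >>.
    by have := SMn _ n (S1 k); rewrite -monalgUMn natz.
  case: c => n; first exact: SUn.
  by rewrite NegzE monalgUN; apply: SN; exact: SUn.
rewrite (monalgE f) -/(S _); elim/big_ind: _ => [||k _]; [exact: S0 | exact: SD | exact: SU].
Qed.

Definition ghostlike (g : nat -> ipoly I) : Prop :=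
  forall n, eqmodn (p ^ n.+1) (g n.+1) (ipfrob (g n)).

(** Dwork's lemma. *)
Lemma ghost_unghost (g : nat -> ipoly I) :
  ghostlike g -> ghost p (unghost p g) =1 g.
Proof.
move=> gg n; have p_gt0 := prime_gt0 p_pr.
elim: n {-2}n (leqnn n) => [|N IHN] n le_nN.
  move: le_nN; rewrite leqn0 => /eqP->.
  rewrite /ghost big_ord1 unghostE big_ord0 subr0 !expn0 expr1 ipdivK //.
  by exists (g 0%N); rewrite add0r.
rewrite /ghost big_ord_recr /= subnn expn0 expr1 [unghost p g n]unghostE ipdivK.
- by rewrite addrC subrK.
- by rewrite expn_gt0 p_gt0.
case: n le_nN => [|n] le_nN.
  by rewrite big_ord0 subr0; exists (g 0%N); rewrite add0r.
suff [c ->]: eqmodn (p ^ n.+1) (g n.+1)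
    (\sum_(i < n.+1) unghost p g i ^+ (p ^ (n.+1 - i)) *+ p ^ i).
  by exists c; rewrite addrAC subrr.
apply: eqmodn_trans (gg n) _; rewrite -IHN // rmorph_ghost.
apply: eqmodn_sum => i; have le_in : (i <= n)%N by rewrite -ltnS.
have -> : (p ^ n.+1 = p ^ (n - i).+1 * p ^ i)%N by rewrite -expnD addSn subnK.
apply: eqmodnMn; rewrite subSn // [in X in eqmodn _ _ X]expnS exprM.
apply: eqmodn_pXn; exact: ipfrobP.
Qed.

Lemma ghostlike_var (v : nat -> I) :
  ghostlike (ghost p (fun n => ivar (v n))).
Proof.
move=> n; exists (ivar (v n.+1)).
have -> : ipfrob (ghost p (fun n => ivar (v n)) n) =
          ghost p (fun n => ivar (v n) ^+ p) n.
  by rewrite rmorph_ghost; apply: eq_ghost => i; exact: ipfrob_var.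
exact: ghostS.
Qed.

Lemma ghostlikeD g h : ghostlike g -> ghostlike h -> ghostlike (g \+ h).
Proof. by move=> gg gh n; rewrite /= rmorphD; apply: eqmodnD. Qed.

Lemma ghostlikeM g h : ghostlike g -> ghostlike h -> ghostlike (g \* h).
Proof. by move=> gg gh n; rewrite /= rmorphM; apply: eqmodnM. Qed.

Lemma ghostlikeN g : ghostlike g -> ghostlike (\- g).
Proof. by move=> gg n; rewrite /= rmorphN; apply: eqmodnN. Qed.

End Dwork.

Record witt (p : nat) (p_pr : prime p) (A : Type) := Witt { wcoef :> nat -> A }.

Section WittChoice.
Variables (p : nat) (p_pr : prime p).
HB.instance Definition _ (A : Type) := [isNew for @wcoef p p_pr A].
HB.instance Definition _ (A : choiceType) := [Choice of witt p_pr A by <:].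
End WittChoice.

(** The indices [inl n] and [inr n] stand for the [n]-th coordinates of the
    first and of the second argument. *)
Definition wvarl (n : nat) : ipoly (nat + nat)%type := ivar (inl n).
Definition wvarr (n : nat) : ipoly (nat + nat)%type := ivar (inr n).

HB.lock Definition wadd_poly (p : nat) : nat -> ipoly (nat + nat)%type :=
  unghost p (ghost p wvarl \+ ghost p wvarr).
HB.lock Definition wmul_poly (p : nat) : nat -> ipoly (nat + nat)%type :=
  unghost p (ghost p wvarl \* ghost p wvarr).
HB.lock Definition wopp_poly (p : nat) : nat -> ipoly (nat + nat)%type :=
  unghost p (\- ghost p wvarl).

Lemma ghost_wadd_poly p :
  prime p -> ghost p (wadd_poly p) =1 ghost p wvarl \+ ghost p wvarr.
Proof.
rewrite wadd_poly.unlock => p_pr.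
by apply: ghost_unghost => //; apply: ghostlikeD; exact: ghostlike_var.
Qed.

Lemma ghost_wmul_poly p :
  prime p -> ghost p (wmul_poly p) =1 ghost p wvarl \* ghost p wvarr.
Proof.
rewrite wmul_poly.unlock => p_pr.
by apply: ghost_unghost => //; apply: ghostlikeM; exact: ghostlike_var.
Qed.

Lemma ghost_wopp_poly p :
  prime p -> ghost p (wopp_poly p) =1 \- ghost p wvarl.
Proof.
rewrite wopp_poly.unlock => p_pr.
by apply: ghost_unghost => //; apply: ghostlikeN; exact: ghostlike_var.
Qed.

Section WittOperations.
Variables (p : nat) (p_pr : prime p).
Local Notation W := (witt p_pr).

Section Operations.
Variable A : comNzRingType.
Implicit Types x y z : W A.

Definition wcoords x y (v : nat + nat) : A :=
  match v with inl n => x n | inr n => y n end.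

Definition wadd x y : W A := Witt p_pr (ipeval (wcoords x y) \o wadd_poly p).
Definition wmul x y : W A := Witt p_pr (ipeval (wcoords x y) \o wmul_poly p).
Definition wopp x : W A := Witt p_pr (ipeval (wcoords x x) \o wopp_poly p).
Definition wzero : W A := Witt p_pr (fun=> 0).
Definition wone : W A := Witt p_pr (fun n => (n == 0%N)%:R).

Lemma ipeval_ghostl x y n :
  ipeval (wcoords x y) (ghost p wvarl n) = ghost p x n.
Proof. by rewrite rmorph_ghost; apply: eq_ghost => i; exact: ipeval_var. Qed.

Lemma ipeval_ghostr x y n :
  ipeval (wcoords x y) (ghost p wvarr n) = ghost p y n.
Proof. by rewrite rmorph_ghost; apply: eq_ghost => i; exact: ipeval_var. Qed.

Lemma ghost_wadd x y n : ghost p (wadd x y) n = ghost p x n + ghost p y n.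
Proof.
rewrite -(rmorph_ghost p (ipeval (wcoords x y))) ghost_wadd_poly // rmorphD.
by congr (_ + _); [exact: ipeval_ghostl | exact: ipeval_ghostr].
Qed.

Lemma ghost_wmul x y n : ghost p (wmul x y) n = ghost p x n * ghost p y n.
Proof.
rewrite -(rmorph_ghost p (ipeval (wcoords x y))) ghost_wmul_poly // rmorphM.
by congr (_ * _); [exact: ipeval_ghostl | exact: ipeval_ghostr].
Qed.

Lemma ghost_wopp x n : ghost p (wopp x) n = - ghost p x n.
Proof.
rewrite -(rmorph_ghost p (ipeval (wcoords x x))) ghost_wopp_poly // rmorphN.
by congr (- _); exact: ipeval_ghostl.
Qed.

Lemma ghost_wzero n : ghost p wzero n = 0.
Proof.
apply: big1 => i _.
by rewrite expr0n expn_eq0 (gtn_eqF (prime_gt0 p_pr)) mul0rn.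
Qed.

Lemma ghost_wone n : ghost p wone n = 1.
Proof.
rewrite /ghost big_ord_recl big1 ?addr0 ?expr1n // => i _.
by rewrite expr0n expn_eq0 (gtn_eqF (prime_gt0 p_pr)) mul0rn.
Qed.

Lemma wittP x y : x =1 y -> x = y.
Proof. by case: x y => [x] [y] /= /funext->. Qed.

End Operations.

Lemma ghost_inj (A : comNzRingType) (x y : W A) :
  (forall d, (0 < d)%N -> injective (fun a : A => a *+ d)) ->
  ghost p x =1 ghost p y -> x = y.
Proof.
move=> tf exy; apply: wittP => n.
elim/ltn_ind: n => n IHn; have := exy n.
rewrite /ghost !big_ord_recr /= subnn expn0 !expr1.
rewrite (eq_bigr (fun i : 'I_n => y i ^+ (p ^ (n - i)) *+ p ^ i)); last first.
  by move=> i _; rewrite IHn.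
by move/addrI; apply: tf; rewrite expn_gt0 prime_gt0.
Qed.

Definition wmap (A B : Type) (f : A -> B) (x : W A) : W B := Witt p_pr (f \o x).

Section Functoriality.
Variables (A B : comNzRingType) (f : {rmorphism A -> B}).
Implicit Types x y : W A.

Lemma rmorph_ipeval (I : choiceType) (v : I -> A) P :
  f (ipeval v P) = ipeval (f \o v) P.
Proof.
rewrite /ipeval /mmap rmorph_sum; apply: eq_bigr => m _.
rewrite rmorphM /= rmorph_int rmorph_prod; congr (_ * _).
by apply: eq_bigr => i _; rewrite rmorphXn.
Qed.

Lemma comp_wcoords x y : f \o wcoords x y =1 wcoords (wmap f x) (wmap f y).
Proof. by case. Qed.

Lemma wmapD x y : wmap f (wadd x y) = wadd (wmap f x) (wmap f y).
Proof.
by apply: wittP => n; rewrite /= rmorph_ipeval (funext (comp_wcoords x y)).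
Qed.

Lemma wmapM x y : wmap f (wmul x y) = wmul (wmap f x) (wmap f y).
Proof.
by apply: wittP => n; rewrite /= rmorph_ipeval (funext (comp_wcoords x y)).
Qed.

Lemma wmapN x : wmap f (wopp x) = wopp (wmap f x).
Proof.
by apply: wittP => n; rewrite /= rmorph_ipeval (funext (comp_wcoords x x)).
Qed.

Lemma wmap0 : wmap f (wzero A) = wzero B.
Proof. by apply: wittP => n; rewrite /= rmorph0. Qed.

Lemma wmap1 : wmap f (wone A) = wone B.
Proof. by apply: wittP => n; rewrite /= rmorph_nat. Qed.

End Functoriality.

(** The ring axioms are checked on ghost components over a torsion-free ring
    having [A] as a quotient. *)
Section Quotient.
Variables (T A : comNzRingType) (pi : {rmorphism T -> A}) (s : A -> T).
Hypothesis T_tf : forall d, (0 < d)%N -> injective (fun t : T => t *+ d).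
Hypothesis sK : cancel s pi.
Implicit Types x y z : W A.

Let lift x : W T := wmap s x.

Let liftK x : x = wmap pi (lift x).
Proof. by apply: wittP => n; rewrite /= sK. Qed.

Let lift_inj (u v : W T) : ghost p u =1 ghost p v -> u = v.
Proof. exact: ghost_inj. Qed.

Lemma waddA_quo : associative (@wadd A).
Proof.
move=> x y z; rewrite (liftK x) (liftK y) (liftK z) -!(wmapD pi).
by congr (wmap _ _); apply: lift_inj => n; rewrite !ghost_wadd addrA.
Qed.

Lemma waddC_quo : commutative (@wadd A).
Proof.
move=> x y; rewrite (liftK x) (liftK y) -!(wmapD pi).
by congr (wmap _ _); apply: lift_inj => n; rewrite !ghost_wadd addrC.
Qed.

Lemma wadd0_quo : left_id (wzero A) (@wadd A).
Proof.
move=> x; rewrite (liftK x) -(wmap0 pi) -!(wmapD pi).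
by congr (wmap _ _); apply: lift_inj => n; rewrite ghost_wadd ghost_wzero add0r.
Qed.

Lemma waddN_quo : left_inverse (wzero A) (@wopp A) (@wadd A).
Proof.
move=> x; rewrite (liftK x) -(wmap0 pi) -!(wmapN pi) -!(wmapD pi).
congr (wmap _ _); apply: lift_inj => n.
by rewrite ghost_wadd ghost_wopp ghost_wzero addNr.
Qed.

Lemma wmulA_quo : associative (@wmul A).
Proof.
move=> x y z; rewrite (liftK x) (liftK y) (liftK z) -!(wmapM pi).
by congr (wmap _ _); apply: lift_inj => n; rewrite !ghost_wmul mulrA.
Qed.

Lemma wmulC_quo : commutative (@wmul A).
Proof.
move=> x y; rewrite (liftK x) (liftK y) -!(wmapM pi).
by congr (wmap _ _); apply: lift_inj => n; rewrite !ghost_wmul mulrC.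
Qed.

Lemma wmul1_quo : left_id (wone A) (@wmul A).
Proof.
move=> x; rewrite (liftK x) -(wmap1 pi) -!(wmapM pi).
by congr (wmap _ _); apply: lift_inj => n; rewrite ghost_wmul ghost_wone mul1r.
Qed.

Lemma wmulDl_quo : left_distributive (@wmul A) (@wadd A).
Proof.
move=> x y z; rewrite (liftK x) (liftK y) (liftK z) -!(wmapD pi) -!(wmapM pi) -!(wmapD pi).
congr (wmap _ _); apply: lift_inj => n.
by rewrite ghost_wmul !ghost_wadd !ghost_wmul mulrDl.
Qed.

End Quotient.

Section Ring.
Variable A : comNzRingType.

Let pi : {rmorphism ipoly A -> A} := ipeval (fun a : A => a).

Let sK : cancel (@ivar A) pi.
Proof. by move=> a; exact: ipeval_var. Qed.

Let tf := @ipoly_mulrn_inj A.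

Lemma waddA : associative (@wadd A). Proof. exact: waddA_quo tf sK. Qed.
Lemma waddC : commutative (@wadd A). Proof. exact: waddC_quo tf sK. Qed.
Lemma wadd0 : left_id (wzero A) (@wadd A). Proof. exact: wadd0_quo tf sK. Qed.
Lemma waddN : left_inverse (wzero A) (@wopp A) (@wadd A).
Proof. exact: waddN_quo tf sK. Qed.
Lemma wmulA : associative (@wmul A). Proof. exact: wmulA_quo tf sK. Qed.
Lemma wmulC : commutative (@wmul A). Proof. exact: wmulC_quo tf sK. Qed.
Lemma wmul1 : left_id (wone A) (@wmul A). Proof. exact: wmul1_quo tf sK. Qed.
Lemma wmulDl : left_distributive (@wmul A) (@wadd A).
Proof. exact: wmulDl_quo tf sK. Qed.

Lemma wone_neq0 : wone A != wzero A.
Proof.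
apply/eqP => /(congr1 (fun x : W A => x 0%N)) /= /eqP.
by rewrite (negbTE (oner_neq0 A)).
Qed.

End Ring.
End WittOperations.

HB.instance Definition _ p (p_pr : prime p) (A : comNzRingType) :=
  GRing.isZmodule.Build (witt p_pr A)
    (@waddA _ _ A) (@waddC _ _ A) (@wadd0 _ _ A) (@waddN _ _ A).
HB.instance Definition _ p (p_pr : prime p) (A : comNzRingType) :=
  GRing.Zmodule_isComNzRing.Build (witt p_pr A)
    (@wmulA _ _ A) (@wmulC _ _ A) (@wmul1 _ _ A) (@wmulDl _ _ A)
    (@wone_neq0 _ _ A).

Section WittUnits.
Variables (p : nat) (p_pr : prime p) (A : comNzRingType).
Implicit Types x y : witt p_pr A.

Definition wunit : {pred witt p_pr A} := fun x => `[< exists y, y * x = 1 >].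

Definition winv x : witt p_pr A :=
  if pselect (exists y, y * x = 1) is left ex_y then projT1 (cid ex_y) else x.

Lemma wmulVx : {in wunit, left_inverse 1 winv *%R}.
Proof.
move=> x /asboolP ux; rewrite /winv; case: pselect => // ex_y.
by case: cid.
Qed.

Lemma wunitPl x y : y * x = 1 -> wunit x.
Proof. by move=> yx1; apply/asboolP; exists y. Qed.

Lemma winv_out : {in [predC wunit], winv =1 id}.
Proof.
move=> x nux; rewrite /winv; case: pselect => // ux.
by case/negP: nux; apply/asboolP.
Qed.

HB.instance Definition _ :=
  GRing.ComNzRing_hasMulInverse.Build (witt p_pr A) wmulVx wunitPl winv_out.

End WittUnits.

(* Main.v *)
Require Import Defs.
From HB Require Import structures.
From mathcomp Require Import all_boot all_order all_algebra.
From mathcomp Require Import boolp.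
From mathcomp.multinomials Require Import monalg.
From mathcomp Require Import fieldext ring.

(** Call a domain [D] completely integrally closed if [u] in its fraction field
    lies in [D] as soon as some [c != 0] in [D] satisfies [c * u ^+ n \in D] for
    all [n]. This implies that [D] is integrally closed, and is equivalent to it
    when [D] is Noetherian; in contrast to integral closedness it lifts along
    [W(B) -> B].

    From [R] to [B]: if [c * u ^+ n] is integral over [R] for all [n], the same
    holds for all conjugates of [u], hence the coefficients of its minimal
    polynomial are almost integral over [R], so they lie in [R] and [u] is
    integral over [R].

    From [B] to [W(B)]: [W(B)] is [p]-adically complete with [W(B) / p = B]. If
    [c * a ^+ n] is divisible by [b ^+ n] for all [n], with [b], [c] prime to
    [p], then [b] divides [a] modulo [p], and writing [a = b * t + p * a1] the
    element [a1] satisfies the same hypothesis with the same [c]. Iterating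
    shows that [b] divides [a]. *)

Set Implicit Arguments.
Unset Strict Implicit.
Unset Printing Implicit Defensive.

Import GRing.Theory.
Local Open Scope ring_scope.

(** * Complete integral closedness and its relation to integral closedness *)

Lemma fraction_div (D : idomainType) (u : {fraction D}) :
  exists a b : D, b != 0 /\ u = tofrac a / tofrac b.
Proof.
elim/generic_quotient.quotW: u => x; have x0 := denom_ratioP x.
exists (frac x).1, (frac x).2; split=> //.
apply: (@mulIf _ (tofrac (frac x).2)); rewrite ?tofrac_eq0 //.
rewrite divfK ?tofrac_eq0 //.
rewrite -[_ * _]/(FracField.mul _ _) !generic_quotient.piE.
apply/generic_quotient.eqmodP; rewrite /= FracField.equivfE /FracField.mulf.
rewrite !numden_Ratio ?mulf_neq0 ?oner_neq0 //.
by rewrite !mulr1 mulrC.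
Qed.

(** Here [a / b] plays the role of [u]. Clearing denominators leaves only divisibility in [D], which
    can be pushed through a ring morphism that does not extend to fractions. *)
Definition completely_integrally_closed (D : idomainType) : Prop :=
  forall a b c : D, b != 0 -> c != 0 ->
  (forall n, exists y, c * a ^+ n = b ^+ n * y) -> exists t, a = b * t.

Lemma cic_fraction (D : idomainType) (u : {fraction D}) (c : D) :
  completely_integrally_closed D -> c != 0 ->
  (forall n, exists y, tofrac c * u ^+ n = tofrac y) -> exists a, u = tofrac a.
Proof.
have [a [b [b0 ->]]] := fraction_div u => cicD c0 cu.
have tb0 : tofrac b != 0 by rewrite tofrac_eq0.
have [n|t ->] := cicD a b c b0 c0; last first.
  by exists t; rewrite rmorphM /= mulrC mulKf.
have [y] := cu n; rewrite expr_div_n mulrA.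
move=> /(canRL (divfK (expf_neq0 n tb0))) E.
by exists y; apply/eqP; rewrite -tofrac_eq !rmorphM !rmorphXn /= E mulrC.
Qed.

Lemma cic_of_fraction (D : idomainType) :
  (forall (u : {fraction D}) c, c != 0 ->
     (forall n, exists y, tofrac c * u ^+ n = tofrac y) ->
     exists a, u = tofrac a) ->
  completely_integrally_closed D.
Proof.
move=> H a b c b0 c0 cab; have tb0 : tofrac b != 0 by rewrite tofrac_eq0.
have [n|t] := H (tofrac a / tofrac b) c c0.
  have [y def_y] := cab n; exists y; rewrite expr_div_n mulrA.
  apply: (canLR (mulfK (expf_neq0 n tb0))).
  by rewrite -!rmorphXn -!rmorphM def_y mulrC.
move/(canRL (divfK tb0)) => E; exists t.
by apply/eqP; rewrite -tofrac_eq E rmorphM mulrC.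
Qed.

(** Modulo the monic equation [q] of [u = a / b], every power of [u] reduces to a polynomial in [u]
    of size at most [size q], so [b ^+ size q] is a common denominator of all powers. *)
Lemma cic_integrally_closed (D : idomainType) :
  completely_integrally_closed D -> integrally_closed D.
Proof.
move=> cicD u [q q_mon qu0].
have [a [b [b0 def_u]]] := fraction_div u.
have tb0 : tofrac b != 0 by rewrite tofrac_eq0.
apply: (cic_fraction cicD (expf_neq0 (size q) b0)) => n.
pose r := Pdiv.Ring.rmodp 'X^n q.
have -> : u ^+ n = (map_poly (@tofrac D) r).[u].
  rewrite -hornerXn -(map_polyXn (@tofrac D)).
  rewrite {1}(Pdiv.RingMonic.rdivp_eq q_mon 'X^n) rmorphD rmorphM /=.
  by rewrite hornerD hornerM (rootP qu0) mulr0 add0r.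
have szr : (size r <= size q)%N.
  by apply/ltnW; rewrite Pdiv.Ring.ltn_rmodp monic_neq0.
exists (\sum_(i < size q) r`_i * (a ^+ i * b ^+ (size q - i))).
rewrite (horner_coef_wide (n := size q)); last first.
  exact: leq_trans (size_poly _ _) szr.
rewrite mulr_sumr rmorph_sum; apply: eq_bigr => i _; rewrite coef_map /=.
rewrite !rmorphM !rmorphXn /= def_u -{1}(subnK (ltnW (ltn_ord i))) exprD.
rewrite expr_div_n mulrCA; congr (_ * _).
by rewrite -mulrA [X in _ * X]mulrC divfK ?expf_neq0 // mulrC.
Qed.

(** The hypothesis puts [c * D[u]] inside [D], where it is an ideal, hence generated by finitely
    many [c * q i (u)]. Writing [c * u ^+ N] on these generators for large [N] and cancelling [c]
    gives a monic equation for [u]. *)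
Lemma noetherian_cic (D : idomainType) :
  noetherian D -> integrally_closed D -> completely_integrally_closed D.
Proof.
move=> noeD icD; apply: cic_of_fraction => u c c0 cu; apply: icD.
pose ev (q : {poly D}) := (map_poly (@tofrac D) q).[u].
have ev0 : ev 0 = 0 by rewrite /ev rmorph0 horner0.
have evD q1 q2 : ev (q1 + q2) = ev q1 + ev q2 by rewrite /ev rmorphD hornerD.
have evM q1 q2 : ev (q1 * q2) = ev q1 * ev q2 by rewrite /ev rmorphM hornerM.
have evC a : ev a%:P = tofrac a by rewrite /ev map_polyC hornerC.
have evX n : ev 'X^n = u ^+ n by rewrite /ev map_polyXn hornerXn.
pose I (x : D) := exists q, tofrac x = tofrac c * ev q.
have [|n [g gP]] := noeD I.
  split=> [|x y [q1 E1] [q2 E2]|a x [q E]].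
  - by exists 0; rewrite ev0 mulr0 tofrac0.
  - by exists (q1 + q2); rewrite evD mulrDr -E1 -E2 rmorphD.
  by exists (a%:P * q); rewrite evM evC mulrCA -E rmorphM.
have gI i : I (g i).
  apply/gP; exists (fun j => (j == i)%:R).
  rewrite (bigD1 i) //= eqxx mul1r big1 ?addr0 // => j /negPf->.
  by rewrite mul0r.
have /choice[q qP] := gI.
(* All [q i] have degree below [N], so subtracting a combination of them from ['X^N] leaves a monic
   polynomial. *)
pose N := \max_i size (q i).
have [x xE] := cu N.
have /gP[r xr] : I x by exists 'X^N; rewrite evX xE.
pose s := \sum_i (r i)%:P * q i.
have sz_s : (size s <= N)%N.
  apply: leq_trans (size_sum _ _ _) _; apply/bigmax_leqP => i _.
  rewrite mul_polyC; apply: leq_trans (size_scale_leq _ _) _.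
  exact: (@leq_bigmax _ (fun i => size (q i))).
exists ('X^N - s).
  by rewrite monicE lead_coefDl ?lead_coefXn // size_polyN size_polyXn ltnS.
apply/rootP; rewrite -/(ev _) evD evX.
have -> : ev (- s) = - ev s by rewrite /ev rmorphN hornerN.
have tc0 : tofrac c != 0 by rewrite tofrac_eq0.
apply/(mulfI tc0); rewrite mulr0 mulrBr xE xr rmorph_sum /=.
have -> : ev s = \sum_i ev ((r i)%:P * q i) by rewrite (big_morph ev evD ev0).
rewrite mulr_sumr -sumrB big1 // => i _.
by rewrite evM evC rmorphM /= qP mulrCA subrr.
Qed.

(** * Splitting fields over an arbitrary field *)

Lemma exists_irreducible_factor (K : fieldType) (p : {poly K}) :
  (1 < size p)%N -> exists2 q, irreducible_poly q & q %| p.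
Proof.
move=> p_gt1.
pose P n := `[< exists2 q : {poly K}, (1 < size q)%N /\ q %| p & size q = n >].
have exP : exists n, P n by exists (size p); apply/asboolP; exists p.
case: (ex_minnP exP) => n /asboolP[q [q_gt1 q_p] sz_q] minP.
exists q => //; split=> // r r1 r_q.
have q0 : q != 0 by rewrite -size_poly_gt0 ltnW.
have r0 : r != 0 by apply: contraNneq q0 => r0; rewrite -dvd0p -r0.
rewrite -dvdp_size_eqp // eqn_leq dvdp_leq //= sz_q; apply: minP.
apply/asboolP; exists r => //; split; last exact: dvdp_trans q_p.
by rewrite ltn_neqAle eq_sym r1 size_poly_gt0.
Qed.

(** Induction on the size: adjoin a root of an irreducible factor and split off the linear factor.
    The base field changes at each stage, so it is generalized in the induction. *)
Lemma exists_splitting_field (K : fieldType) (p : {poly K}) : p \is monic ->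
  exists (E : fieldType) (iota : {rmorphism K -> E}) (rs : seq E),
    map_poly iota p = \prod_(z <- rs) ('X - z%:P).
Proof.
have [n] := ubnP (size p); elim: n K p => // n IHn K p le_n p_mon.
have [p_le1|p_gt1] := leqP (size p) 1.
  exists K, idfun, [::]; rewrite big_nil map_poly_id //.
  by move: p_mon; rewrite (size1_polyC p_le1) monicE lead_coefC => /eqP->.
have [q irr_q q_p] := exists_irreducible_factor p_gt1.
have [L _ [z qz _]] := irredp_FAdjoin irr_q.
have /factor_theorem[p1 def_p1] : root (map_poly (in_alg L) p) z.
  by have /dvdpP[r ->] := q_p; rewrite rmorphM rootM qz orbT.
have p1_mon : p1 \is monic.
  by rewrite -(monicMr _ (monicXsubC z)) -def_p1 monic_map.
have [|E [iota [rs def_rs]]] := IHn L p1 _ p1_mon.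
  rewrite -ltnS; apply: leq_trans le_n.
  rewrite -(size_map_poly (in_alg L)) def_p1 size_Mmonic ?monicXsubC //.
    by rewrite size_XsubC addn2.
  exact: monic_neq0.
exists E, (iota \o in_alg L), (iota z :: rs).
rewrite map_poly_comp /= def_p1 rmorphM /= def_rs map_polyXsubC.
by rewrite big_cons mulrC.
Qed.

(** * Almost integral elements of an extension field *)

Section AlmostIntegral.
Variables (R : idomainType) (E : fieldType) (h : {rmorphism R -> E}).

(** Asking for integrality over [R], not membership in [R], makes the notion meaningful for
    conjugates lying outside the fraction field. *)
Definition almost_integral (x : E) : Prop :=
  exists2 c, c != 0 & forall n, integralOver h (h c * x ^+ n).

Lemma integral_sum (I : Type) (s : seq I) (F : I -> E) :
  (forall i, integralOver h (F i)) -> integralOver h (\sum_(i <- s) F i).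
Proof.
move=> intF; elim/big_ind: _ => // [|x y]; first exact: integral0.
exact: integral_add.
Qed.

Lemma almost_integral_nat n : almost_integral n%:R.
Proof.
exists 1; rewrite ?oner_neq0 // => m.
by rewrite rmorph1 mul1r -natrX; apply: integral_nat.
Qed.

Lemma almost_integralM x y :
  almost_integral x -> almost_integral y -> almost_integral (x * y).
Proof.
move=> [c c0 cx] [d d0 dy]; exists (c * d); first by rewrite mulf_neq0.
by move=> n; rewrite rmorphM exprMn mulrACA; apply: integral_mul.
Qed.

(** Each binomial term of [c * d * (x + y) ^+ n] is an integer multiple of some
    [(c * x ^+ i) * (d * y ^+ j)], so the product of the two denominators works. *)
Lemma almost_integralD x y :
  almost_integral x -> almost_integral y -> almost_integral (x + y).
Proof.
move=> [c c0 cx] [d d0 dy]; exists (c * d); first by rewrite mulf_neq0.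
move=> n; rewrite rmorphM exprDn mulr_sumr; apply: integral_sum => i.
rewrite -mulr_natr mulrA mulrACA; apply: integral_mul; last exact: integral_nat.
exact: integral_mul.
Qed.

Lemma almost_integralN x : almost_integral x -> almost_integral (- x).
Proof.
move=> [c c0 cx]; exists c => // n; rewrite exprNn mulrCA.
apply: integral_mul => //; elim: n => [|n IHn]; first exact: integral1.
by rewrite exprS mulN1r; apply: integral_opp.
Qed.

Lemma almost_integral_coef_prod_XsubC (rs : seq E) i :
  (forall z, z \in rs -> almost_integral z) ->
  almost_integral (\prod_(z <- rs) ('X - z%:P))`_i.
Proof.
elim: rs i => [|z rs IHrs] i rsP.
  by rewrite big_nil coef1; apply: almost_integral_nat.
have {}IHrs j : almost_integral (\prod_(y <- rs) ('X - y%:P))`_j.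
  by apply: IHrs => y y_rs; apply: rsP; rewrite inE y_rs orbT.
rewrite big_cons mulrBl coefB coefXM coefCM; apply: almost_integralD.
  by case: ifP => _; [exact: almost_integral_nat 0%N | exact: IHrs].
apply: almost_integralN; apply: almost_integralM => //.
by apply: rsP; rewrite mem_head.
Qed.

End AlmostIntegral.

(** * Complete integral closedness along an integral extension *)

Lemma cic_almost_integral (R : idomainType) (E : fieldType)
    (iota : {rmorphism {fraction R} -> E}) (x : {fraction R}) :
  completely_integrally_closed R ->
  almost_integral (iota \o @tofrac R) (iota x) -> exists r, x = tofrac r.
Proof.
move=> cicR [c c0 cx]; apply: (cic_fraction cicR c0) => n.
apply: (cic_integrally_closed cicR); have [q q_mon qx] := cx n.
exists q => //; move: qx.
by rewrite map_poly_comp /= -rmorphXn -rmorphM fmorph_root.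
Qed.

(** Since [c != 0], factors ['X] can be removed from [q] until its constant term is nonzero; the
    equation then shows that this term is a multiple of [c]. *)
Lemma integral_divides (R B : idomainType) (f : {rmorphism R -> B})
    (q : {poly R}) (c : B) : injective f -> q != 0 -> c != 0 ->
  root (map_poly f q) c -> exists2 r, r != 0 & exists d, f r = c * d.
Proof.
move=> f_inj; elim/poly_ind: q => [|q a IHq]; first by rewrite eqxx.
rewrite rmorphD rmorphM /= map_polyX map_polyC /= /root.
rewrite hornerD hornerM hornerX hornerC.
have [->|a0] := eqVneq a 0.
  rewrite addr0 rmorph0 addr0 => qX0 c0.
  rewrite mulf_eq0 (negPf c0) orbF => qc; apply: IHq => //.
  by apply: contraNneq qX0 => ->; rewrite mul0r.
move=> _ c0; rewrite addrC addr_eq0 => /eqP fa; exists a => //.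
by exists (- (map_poly f q).[c]); rewrite mulrN mulrC.
Qed.

Lemma cic_integral_extension (R B : idomainType) (f : {rmorphism R -> B}) :
  injective f -> integralRange f -> completely_integrally_closed R ->
  integrally_closed B -> completely_integrally_closed B.
Proof.
move=> f_inj intB cicR icB; apply: cic_of_fraction => u c c0 cu.
pose g : {rmorphism R -> {fraction B}} := @tofrac B \o f.
have g_inj : injective g by move=> x y /= /eqP; rewrite tofrac_eq => /eqP/f_inj.
(* The denominator [c] is replaced by a multiple coming from [R], so that the same denominator can
   serve for the conjugates of [u]. *)
have [s s_mon sc] := intB c.
have [r r0 [d fr]] := integral_divides f_inj (monic_neq0 s_mon) c0 sc.
have /choice[Q QP] n :
    exists q : {poly R}, q \is monic /\ root (map_poly g q) (g r * u ^+ n).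
  have [y yE] := cu n.
  have [q q_mon qy] := integral_rmorph (@tofrac B) (intB (y * d)).
  exists q; split=> //; rewrite /= fr rmorphM /= mulrAC yE -rmorphM.
  exact: qy.
(* [QX n] encodes as a root condition on [z] that [r * z ^+ n] is killed by the monic [Q n]; this
   condition passes from [u] to its conjugates. *)
pose QX n := Q n \Po (r *: 'X^n).
have QX_root n (F : fieldType) (k : {rmorphism R -> F}) z :
    root (map_poly k (QX n)) z = root (map_poly k (Q n)) (k r * z ^+ n).
  rewrite /root map_comp_poly horner_comp linearZ /= map_polyXn.
  by rewrite hornerZ hornerXn.
pose kills n := `[< exists2 P : {poly R},
  P != 0 /\ root (map_poly g P) u & size P = n >].
have ex_kills : exists n, kills n.
  exists (size (QX 1%N)); apply/asboolP; exists (QX 1%N) => //; split.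
    rewrite -size_poly_gt0 size_comp_poly2 ?size_scale ?size_polyXn //.
    by rewrite size_poly_gt0 monic_neq0 // (QP 1%N).1.
  by rewrite QX_root (QP 1%N).2.
(* [P] is a minimal polynomial of [u] with denominators cleared, hence possibly not monic. *)
have [P [P0 Pu] minP] : exists2 P : {poly R}, P != 0 /\ root (map_poly g P) u &
    forall S, root (map_poly g S) u -> (size S < size P)%N -> S = 0.
  case: (ex_minnP ex_kills) => n /asboolP[P [P0 Pu] szP] minn.
  exists P => // S Su; rewrite szP ltnNge => /negP nS; apply/eqP/contraT => S0.
  by case: nS; apply: minn; apply/asboolP; exists S.
(* Pseudo-division over [R]: divisibility by [P] holds up to a power of its leading coefficient,
   which does not affect roots in a field. *)
have P_dvd S : root (map_poly g S) u ->
    exists (k : nat) (T : {poly R}), (lead_coef P ^+ k) *: S = T * P.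
  move=> Su; have E := Pdiv.Idomain.divp_eq S P.
  suff rem0 : S %% P = 0 by exists (scalp S P), (S %/ P); rewrite E rem0 addr0.
  apply: minP; last by rewrite ltn_modp.
  have := congr1 (fun s => (map_poly g s).[u]) E.
  rewrite linearZ rmorphD rmorphM hornerZ hornerD hornerM.
  by rewrite (rootP Su) (rootP Pu) !mulr0 add0r => /esym/rootP.
pose l := lead_coef P; have l0 : l != 0 by rewrite lead_coef_eq0.
have tl0 : tofrac l != 0 by rewrite tofrac_eq0.
pose PK := (tofrac l)^-1 *: map_poly (@tofrac R) P.
have tofrac_inj : injective (@tofrac R).
  by move=> x y /eqP; rewrite tofrac_eq => /eqP.
have PK_mon : PK \is monic.
  by rewrite monicE lead_coefZ lead_coef_map_inj ?rmorph0 // mulVf.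
have [E [iota [rs def_rs]]] := exists_splitting_field PK_mon.
pose h : {rmorphism R -> E} := iota \o @tofrac R.
have PE : map_poly h P = h l *: \prod_(z <- rs) ('X - z%:P).
  rewrite -def_rs /PK linearZ /= scalerA fmorphV divff ?fmorph_eq0 //.
  by rewrite scale1r map_poly_comp.
have hl0 : h l != 0 by rewrite fmorph_eq0.
have rs_alm z : z \in rs -> almost_integral h z.
  move=> z_rs; exists r => // n; exists (Q n); first exact: (QP n).1.
  rewrite -QX_root; have [|k [T TP]] := P_dvd (QX n).
    by rewrite QX_root (QP n).2.
  have := congr1 (fun s => root (map_poly h s) z) TP.
  rewrite linearZ rmorphM /= rootM PE !rootZ ?rmorphXn ?expf_neq0 //.
  by rewrite root_prod_XsubC z_rs orbT.
have /choice[t tP] i : exists t, PK`_i = tofrac t.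
  apply: (cic_almost_integral (iota := iota)) => //.
  by rewrite -coef_map /= def_rs; apply: almost_integral_coef_prod_XsubC.
(* The monic minimal polynomial [PK] descends to [R], which is the integral equation sought for
   [u]. *)
pose P1 := \poly_(i < size PK) t i.
have P1E : map_poly (@tofrac R) P1 = PK.
  apply/polyP => i; rewrite coef_map coef_poly.
  case: ltnP => [_|/(nth_default 0)->]; first by rewrite tP.
  exact: tofrac0.
have P1_mon : P1 \is monic.
  rewrite monicE -tofrac_eq -lead_coef_map_inj ?rmorph0 // P1E rmorph1.
  exact: PK_mon.
have P_P1 : P = l *: P1.
  apply: (map_inj_poly tofrac_inj (rmorph0 _)).
  by rewrite linearZ /= P1E scalerA divff // scale1r.
apply: icB; exists (map_poly f P1); first exact: monic_map.
rewrite -map_poly_comp; move: Pu; rewrite P_P1 linearZ /= rootZ //.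
by rewrite -(rmorph0 g) (inj_eq g_inj).
Qed.

(** * Valuation by a regular generator of the kernel of a map to a domain *)

Section PrincipalKernel.
Variables (W : comNzRingType) (B : idomainType).
Variables (pi : {rmorphism W -> B}) (w : W).
Hypotheses (pi_w : pi w = 0) (w_reg : forall x, w * x = 0 -> x = 0).
Hypothesis ker_pi : forall x, pi x = 0 -> exists y, x = w * y.
Hypothesis w_separated : forall x,
  (forall n, exists y, x = w ^+ n * y) -> x = 0.

Lemma exp_kernel_gen_reg n x : w ^+ n * x = 0 -> x = 0.
Proof.
elim: n x => [|n IHn] x; first by rewrite mul1r.
by rewrite exprS -mulrA => /w_reg/IHn.
Qed.

Lemma exp_kernel_gen_inj n : injective (fun x => w ^+ n * x).
Proof.
move=> x y /eqP; rewrite -subr_eq0 -mulrBr => /eqP/exp_kernel_gen_reg/eqP.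
by rewrite subr_eq0 => /eqP.
Qed.

Lemma kernel_gen_decomp x : x != 0 -> exists n y, x = w ^+ n * y /\ pi y != 0.
Proof.
move=> x0; pose P n := `[< ~ exists y, x = w ^+ n * y >].
have exP : exists n, P n.
  apply: contrapT => nex; case/eqP: x0; apply: w_separated => n.
  by apply: contrapT => nx; apply: nex; exists n; apply/asboolP.
(* The least exponent whose power does not divide [x] is positive; its predecessor [m] is the
   [w]-adic valuation of [x]. *)
case: (ex_minnP exP) => -[|m] /asboolP nx minm.
  by case: nx; exists x; rewrite mul1r.
have [y xy] : exists y, x = w ^+ m * y.
  by apply: contrapT => /asboolP/minm; rewrite ltnn.
exists m, y; split=> //; apply/eqP => /ker_pi[z yz]; apply: nx.
by exists z; rewrite xy yz mulrA exprSr.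
Qed.

(** Strip the powers of [w] from two nonzero factors: the remaining product has nonzero image in the
    domain [B]. *)
Lemma domain_of_principal_kernel : GRing.integral_domain_axiom W.
Proof.
move=> x y xy0; apply/norP => -[] /kernel_gen_decomp[n [x1 [def_x x1_0]]].
move=> /kernel_gen_decomp[m [y1 [def_y y1_0]]].
have /exp_kernel_gen_reg/(congr1 pi) : w ^+ (n + m) * (x1 * y1) = 0.
  by rewrite exprD mulrACA -def_x -def_y.
by rewrite rmorphM rmorph0 => /eqP; rewrite mulf_eq0 (negPf x1_0) (negPf y1_0).
Qed.

(** The element [w] is prime, being a generator of the kernel of a map to a domain, and [b] is prime
    to it; powers of [w] are moved across one factor at a time. *)
Lemma kernel_gen_exp_gauss n b x y :
  pi b != 0 -> w ^+ n * x = b * y -> exists z, y = w ^+ n * z.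
Proof.
move=> b0; elim: n x y => [|n IHn] x y; first by exists y; rewrite mul1r.
move=> xy; have /ker_pi[y1 def_y] : pi y = 0.
  have /eqP := congr1 pi xy.
  rewrite exprS !rmorphM pi_w !mul0r eq_sym mulf_eq0 (negPf b0) /=.
  by move/eqP.
have [|z def_y1] := IHn x y1.
  apply: (@exp_kernel_gen_inj 1); rewrite /= expr1 mulrA -exprS xy def_y.
  by rewrite mulrCA.
by exists z; rewrite def_y def_y1 mulrA exprS.
Qed.

End PrincipalKernel.

(** * Lifting complete integral closedness from the quotient by [w] *)

Section AdicallyComplete.
Variables (W B : idomainType) (pi : {rmorphism W -> B}) (w : W).
Hypotheses (pi_w : pi w = 0) (w0 : w != 0).
Hypothesis ker_pi : forall x, pi x = 0 -> exists y, x = w * y.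
Hypothesis w_separated : forall x,
  (forall n, exists y, x = w ^+ n * y) -> x = 0.
Hypothesis pi_surj : forall b, exists x, pi x = b.
Hypothesis w_complete : forall t : nat -> W, exists s, forall n,
  exists y, s = \sum_(i < n) w ^+ i * t i + w ^+ n * y.

Let w_reg x : w * x = 0 -> x = 0.
Proof. by move/eqP; rewrite mulf_eq0 (negPf w0) => /eqP. Qed.

Let wX_inj n := @exp_kernel_gen_inj W w w_reg n.
Let decomp := kernel_gen_decomp ker_pi w_separated.
Let gauss := kernel_gen_exp_gauss pi_w w_reg ker_pi.

Definition almost_divides (c b a : W) : Prop :=
  forall n, exists y, c * a ^+ n = b ^+ n * y.

Lemma almost_divides_step b c a : completely_integrally_closed B ->
  pi b != 0 -> pi c != 0 -> almost_divides c b a ->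
  exists t a1, a = b * t + w * a1 /\ almost_divides c b a1.
Proof.
move=> cicB b0 c0 ab.
have [n|t0 def_t0] := cicB (pi a) (pi b) (pi c) b0 c0.
  have [y /(congr1 pi)] := ab n; rewrite !rmorphM !rmorphXn => E.
  by exists (pi y).
have [t def_t] := pi_surj t0.
have /ker_pi[a1 def_a1] : pi (a - b * t) = 0.
  by rewrite rmorphB rmorphM def_t def_t0 subrr.
exists t, a1; split; first by rewrite -def_a1 addrC subrK.
have /choice[Y YP] := ab => n.
(* In the binomial expansion, [c * a ^+ (n - i)] supplies [b ^+ (n - i)] and [(b * t) ^+ i] supplies
   the remaining [b ^+ i]. *)
have [z def_z] : exists z, c * (a - b * t) ^+ n = b ^+ n * z.
  exists (\sum_(i < n.+1) (-1) ^+ i * Y (n - i)%N * t ^+ i *+ 'C(n, i)).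
  rewrite exprBn !mulr_sumr; apply: eq_bigr => i _.
  rewrite !mulrnAr; congr (_ *+ _).
  have -> : b ^+ n = b ^+ (n - i) * b ^+ i by rewrite -exprD subnK // -ltnS.
  transitivity ((-1) ^+ i * (b * t) ^+ i * (c * a ^+ (n - i))); first by ring.
  by rewrite YP exprMn; ring.
have bn0 : pi (b ^+ n) != 0 by rewrite rmorphXn expf_neq0.
(* The left side carries [w ^+ n]; as [b] is prime to [w], this power divides [z] and cancels. *)
move: def_z; rewrite def_a1 exprMn mulrCA => def_z.
have [z1 def_z1] := gauss bn0 def_z.
by exists z1; apply: (@wX_inj n); rewrite /= def_z def_z1 mulrCA.
Qed.

Lemma almost_divides_divides b c a : completely_integrally_closed B ->
  pi b != 0 -> pi c != 0 -> almost_divides c b a -> exists t, a = b * t.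
Proof.
move=> cicB b0 c0 ab.
have /choice[F FP] x : exists p : W * W,
    almost_divides c b x -> x = b * p.1 + w * p.2 /\ almost_divides c b p.2.
  (* The pair [(0, 0)] is a dummy value making the choice function total. *)
  case: (pselect (almost_divides c b x)) => [bx|nbx]; last by exists (0, 0).
  have [t [x1 E]] := almost_divides_step cicB b0 c0 bx.
  by exists (t, x1).
pose A n := iter n (fun x => (F x).2) a.
have AP n : almost_divides c b (A n).
  by elim: n => //= n IHn; have [] := FP _ IHn.
(* [s] is the limit of the series of successive quotients; [a - b * s] is then divisible by every
   power of [w]. *)
have [s sP] := w_complete (fun n => (F (A n)).1).
have aE n : a = b * (\sum_(i < n) w ^+ i * (F (A i)).1) + w ^+ n * A n.
  elim: n => [|n IHn]; first by rewrite big_ord0 mulr0 add0r mul1r.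
  rewrite big_ord_recr /= mulrDr -addrA {1}IHn; congr (_ + _).
  rewrite -/(A n) {1}(FP _ (AP n)).1 exprSr; ring.
exists s; apply/eqP; rewrite -subr_eq0; apply/eqP/w_separated => n.
have [y ->] := sP n; exists (A n - b * y).
by rewrite {1}(aE n) mulrDr opprD addrACA subrr add0r mulrBr mulrCA.
Qed.

Lemma cic_adically_complete :
  completely_integrally_closed B -> completely_integrally_closed W.
Proof.
move=> cicB a b c /decomp[m [b1 [-> b1_0]]] /decomp[k [c1 [-> c1_0]]] ab.
have [a1 def_a] : exists a1, a = w ^+ m * a1.
  have [->|/decomp[v [a0 [def_a a0_0]]]] := eqVneq a 0.
    by exists 0; rewrite mulr0.
  have [le_mv|lt_vm] := leqP m v.
    by exists (w ^+ (v - m) * a0); rewrite mulrA -exprD subnKC.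
  (* If [a] had valuation [v < m], the exponent [k.+1] would already contradict [ab]: the left side
     has valuation [k + v * k.+1], the right side at least [m * k.+1], which is larger. *)
  have [y] := ab k.+1.
  have le_e : (k + v * k.+1 < m * k.+1)%N.
    by have := leq_mul lt_vm (leqnn k.+1); rewrite mulSn addSn.
  rewrite def_a !exprMn -!exprM => E.
  have /(@wX_inj (k + v * k.+1))/(congr1 pi)/eqP :
      w ^+ (k + v * k.+1) * (c1 * a0 ^+ k.+1) =
      w ^+ (k + v * k.+1) *
        (w * (w ^+ (m * k.+1 - (k + v * k.+1).+1) * (b1 ^+ k.+1 * y))).
    rewrite [LHS](_ : _ = w ^+ (m * k.+1) * b1 ^+ k.+1 * y); last first.
      by rewrite -E exprD; ring.
    by rewrite -{1}(subnKC le_e) exprD exprS; ring.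
  rewrite !rmorphM !rmorphXn pi_w mul0r mulf_eq0 expf_eq0.
  by rewrite (negPf c1_0) (negPf a0_0) andbF.
have [n|t def_a1] := @almost_divides_divides b1 c1 a1 cicB b1_0 c1_0; last first.
  by exists t; rewrite def_a def_a1 mulrA.
have [y] := ab n; rewrite def_a !exprMn => E.
have b1n_0 : pi (b1 ^+ n) != 0 by rewrite rmorphXn expf_neq0.
(* After cancelling [w ^+ (m * n)], the factor [w ^+ k] coming from [c] is removed by [gauss], since
   [b1] is prime to [w]. *)
have /(@wX_inj (m * n)) {}E :
    w ^+ (m * n) * (w ^+ k * (c1 * a1 ^+ n)) = w ^+ (m * n) * (b1 ^+ n * y).
  by rewrite exprM [RHS]mulrA -E; ring.
have [z def_z] := gauss b1n_0 E.
by exists z; apply: (@wX_inj k); rewrite /= E def_z mulrCA.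
Qed.

End AdicallyComplete.

(** * Witt coordinates, Verschiebung and multiplication by [p] *)

Section WittCoordinates.
Variables (p : nat) (p_pr : prime p).

Definition eq_below (k : nat) (T : Type) (x y : nat -> T) : Prop :=
  forall n, (n < k)%N -> x n = y n.

Lemma eq_below_ghost (A : pzSemiRingType) k (x y : nat -> A) :
  eq_below k x y -> eq_below k (ghost p x) (ghost p y).
Proof.
move=> xy n lt_nk; apply: eq_bigr => i _; rewrite xy //.
exact: leq_trans (ltn_ord i) lt_nk.
Qed.

Section TorsionFree.
Variable A : comNzRingType.
Hypothesis A_tf : forall d, (0 < d)%N -> injective (fun a : A => a *+ d).

Lemma ghost_eq_below k (x y : nat -> A) :
  eq_below k (ghost p x) (ghost p y) -> eq_below k x y.
Proof.
move=> xy n; elim/ltn_ind: n => n IHn lt_nk; have := xy n lt_nk.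
rewrite /ghost !big_ord_recr /= subnn expn0 !expr1.
rewrite (eq_bigr (fun i : 'I_n => y i ^+ (p ^ (n - i)) *+ p ^ i)); last first.
  by move=> i _; rewrite IHn // (ltn_trans _ lt_nk).
by move/addrI; apply: A_tf; rewrite expn_gt0 prime_gt0.
Qed.

(** If the lower coordinates agree modulo [p], their contributions to the [n]-th ghost component
    agree modulo [p ^ n.+1]. What remains is [p ^ n] times the difference of the last coordinates,
    and torsion-freeness cancels [p ^ n]. *)
Lemma ghost_eqmodn (x y : nat -> A) :
  (forall n, eqmodn (p ^ n.+1) (ghost p x n) (ghost p y n)) ->
  forall n, eqmodn p (x n) (y n).
Proof.
move=> xy; elim/ltn_ind => n IHn; have := xy n.
rewrite /ghost !big_ord_recr /= subnn expn0 !expr1 => E.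
have S : eqmodn (p ^ n.+1) (\sum_(i < n) x i ^+ (p ^ (n - i)) *+ p ^ i)
                           (\sum_(i < n) y i ^+ (p ^ (n - i)) *+ p ^ i).
  apply: eqmodn_sum => i; have lt_in := ltn_ord i.
  have -> : (p ^ n.+1 = p ^ (n - i).+1 * p ^ i)%N.
    by rewrite -expnD addSn subnK // ltnW.
  by apply: eqmodnMn; apply: eqmodn_pXn; apply: IHn.
have [u] := eqmodnD E (eqmodnN S).
rewrite addrAC subrr add0r [X in _ = X + _]addrAC subrr add0r => xyn.
exists u; apply: (A_tf (d := p ^ n)); first by rewrite expn_gt0 prime_gt0.
by rewrite /= xyn mulrnDl -mulrnA -expnS.
Qed.

End TorsionFree.

Lemma ghostMn (A : comNzRingType) (x : witt p_pr A) m n :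
  ghost p (x *+ m) n = ghost p x n *+ m.
Proof.
elim: m => [|m IHm]; first exact: ghost_wzero.
by rewrite !mulrS [LHS]ghost_wadd IHm.
Qed.

Definition verschiebung (A : comNzRingType) (x : witt p_pr A) : witt p_pr A :=
  Witt p_pr (fun n => if n is m.+1 then x m else 0).

Lemma ghost_verschiebung0 (A : comNzRingType) (x : witt p_pr A) :
  ghost p (verschiebung x) 0 = 0.
Proof. by rewrite /ghost big_ord1 subnn expn0 expr1. Qed.

Lemma ghost_verschiebungS (A : comNzRingType) (x : witt p_pr A) n :
  ghost p (verschiebung x) n.+1 = ghost p x n *+ p.
Proof.
rewrite /ghost big_ord_recl /= expr0n expn_eq0 (gtn_eqF (prime_gt0 p_pr)).
rewrite mul0rn add0r -sumrMnl; apply: eq_bigr => i _.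
by rewrite /bump /= add1n subSS expnSr mulrnA.
Qed.

Section Quotient.
Variables (T A : comNzRingType) (pi : {rmorphism T -> A}) (s : A -> T).
Hypothesis T_tf : forall d, (0 < d)%N -> injective (fun t : T => t *+ d).
Hypothesis sK : cancel s pi.

Let liftK (x : witt p_pr A) : wmap pi (wmap s x) = x.
Proof. by apply: wittP => n; rewrite /= sK. Qed.

Lemma eq_belowDr_quo k (x y z : witt p_pr A) :
  eq_below k x y -> eq_below k (x + z) (y + z).
Proof.
move=> xy n lt_nk; rewrite -(liftK x) -(liftK y) -(liftK z).
rewrite -[wmap pi (wmap s x) + _](wmapD pi) -[_ + wmap pi _](wmapD pi).
congr (pi _); apply: (ghost_eq_below T_tf (k := k)) lt_nk => m lt_mk.
rewrite !ghost_wadd; congr (_ + _).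
by apply: eq_below_ghost lt_mk => i lt_ik; rewrite /= xy.
Qed.

(** The two sides, computed on a lift to [T], have ghost components congruent
   modulo [p ^ n.+1], hence coordinates congruent modulo [p]. *)
Lemma witt_mulrn_p_quo (x : witt p_pr A) : p \in [pchar A] ->
  x *+ p = verschiebung (wmap (fun a => a ^+ p) x).
Proof.
move=> pA; pose X : witt p_pr T := wmap s x.
have wmapMn m : wmap pi (X *+ m) = x *+ m.
  elim: m => [|m IHm]; first exact: wmap0.
  by rewrite !mulrS -IHm -{1}(liftK x) [LHS](wmapD pi).
rewrite -wmapMn.
have gX n : eqmodn (p ^ n.+1) (ghost p (X *+ p) n)
    (ghost p (verschiebung (wmap (fun a => a ^+ p) X)) n).
  case: n => [|n].
    exists (X 0%N); rewrite ghostMn ghost_verschiebung0 add0r expn1.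
    by rewrite /ghost big_ord1 subnn expn0 expr1.
  exists (X n.+1); rewrite ghostMn ghost_verschiebungS ghostS.
  by rewrite mulrnDl -mulrnA -expnSr.
apply: wittP => n /=; have [c ->] := ghost_eqmodn T_tf gX n.
rewrite rmorphD rmorphMn /= mulrn_pchar // addr0.
by case: n => [|n]; rewrite ?rmorph0 // rmorphXn /= sK.
Qed.

End Quotient.

Section Ring.
Variable A : comNzRingType.
Implicit Types x y z : witt p_pr A.

Let tf := @ipoly_mulrn_inj A.

Let sK : cancel (@ivar A) (ipeval (fun a : A => a)).
Proof. by move=> a; exact: ipeval_var. Qed.

Lemma eq_belowDr k x y z : eq_below k x y -> eq_below k (x + z) (y + z).
Proof. exact: eq_belowDr_quo tf sK k x y z. Qed.

Lemma eq_below_sub k x y :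
  eq_below k x y <-> eq_below k (x - y) (0 : witt p_pr A).
Proof.
split=> [/(eq_belowDr (- y))|/(eq_belowDr y)]; first by rewrite subrr.
by rewrite subrK add0r.
Qed.

Lemma witt_mulrn_p x : p \in [pchar A] ->
  x *+ p = verschiebung (wmap (fun a => a ^+ p) x).
Proof. exact: witt_mulrn_p_quo tf sK x. Qed.

End Ring.

Definition wcoef0 (A : comNzRingType) (x : witt p_pr A) : A := x 0%N.

(** This identification makes the reduction [W(A) -> A] a ring morphism. *)
Lemma ghost_wcoef0 (A : comNzRingType) (x : witt p_pr A) :
  ghost p x 0 = wcoef0 x.
Proof. by rewrite /ghost big_ord1 subnn !expn0 expr1. Qed.

Lemma wcoef0_zmod_morphism (A : comNzRingType) : zmod_morphism (@wcoef0 A).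
Proof. by move=> x y; rewrite -!ghost_wcoef0 ghost_wadd ghost_wopp. Qed.

Lemma wcoef0_monoid_morphism (A : comNzRingType) : monoid_morphism (@wcoef0 A).
Proof. by split=> // x y; rewrite -!ghost_wcoef0 ghost_wmul. Qed.

HB.instance Definition _ (A : comNzRingType) :=
  GRing.isZmodMorphism.Build (witt p_pr A) A (@wcoef0 A)
    (@wcoef0_zmod_morphism A).
HB.instance Definition _ (A : comNzRingType) :=
  GRing.isMonoidMorphism.Build (witt p_pr A) A (@wcoef0 A)
    (@wcoef0_monoid_morphism A).

End WittCoordinates.

(** * The [p]-adic topology on the Witt vectors of a perfect domain *)

Section PerfectWitt.
Variables (p : nat) (p_pr : prime p) (B : idomainType).
Hypotheses (B_char : p \in [pchar B]) (B_perfect : perfect p B).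
Local Notation W := (witt p_pr B).
Implicit Types x y : W.

Lemma wcoef_pM0 x : (p%:R * x) 0%N = 0.
Proof. by rewrite mulr_natl witt_mulrn_p. Qed.

Lemma wcoef_pMS x n : (p%:R * x) n.+1 = x n ^+ p.
Proof. by rewrite mulr_natl witt_mulrn_p. Qed.

Lemma witt_p_reg x : p%:R * x = 0 -> x = 0.
Proof.
move=> px0; apply: wittP => n; have := congr1 (fun y : W => y n.+1) px0.
by rewrite wcoef_pMS => /eqP; rewrite expf_eq0 => /andP[_ /eqP].
Qed.

(** Multiplication by [p] shifts the coordinates and raises them to the power [p]; perfectness makes
    every shifted vector arise this way. Separatedness and completeness are thereby read off
    coordinates. *)
Lemma witt_pX_dvd n x :
  (exists y, x = p%:R ^+ n * y) <-> eq_below n x (0 : W).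
Proof.
split=> [[y ->]|].
  elim: n y => // n IHn y [_|m lt_mn]; rewrite exprS -mulrA ?wcoef_pM0 //.
  by rewrite wcoef_pMS IHn // expr0n gtn_eqF // prime_gt0.
elim: n x => [|n IHn] x x0; first by exists x; rewrite mul1r.
have [g gK gK'] := B_perfect.
(* Division of [x] by [p]: drop the vanishing first coordinate and take [p]-th roots. *)
have [|y def_y] := IHn (Witt p_pr (fun n => g (x n.+1))).
  move=> m lt_mn; rewrite /= x0 //= -[RHS]gK; congr g.
  by rewrite expr0n gtn_eqF // prime_gt0.
exists y; rewrite exprS -mulrA -def_y; apply: wittP => -[|m].
  by rewrite wcoef_pM0 x0.
by rewrite wcoef_pMS /= gK'.
Qed.

Lemma witt_ker_wcoef0 x : wcoef0 x = 0 -> exists y, x = p%:R * y.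
Proof.
move=> x0; have [|y ->] := (witt_pX_dvd 1 x).2; last by exists y; rewrite expr1.
by case.
Qed.

Lemma wcoef0_p : wcoef0 (p%:R : W) = 0.
Proof. by rewrite -[p%:R]mulr1; exact: wcoef_pM0. Qed.

Lemma witt_p_separated x : (forall n, exists y, x = p%:R ^+ n * y) -> x = 0.
Proof.
by move=> xp; apply: wittP => n; have /(witt_pX_dvd n.+1 x) := xp n.+1; apply.
Qed.

Lemma witt_p_complete (t : nat -> W) : exists s, forall n,
  exists y, s = \sum_(i < n) p%:R ^+ i * t i + p%:R ^+ n * y.
Proof.
pose S n := \sum_(i < n) p%:R ^+ i * t i.
have SS n : eq_below n (S n.+1) (S n).
  have -> : S n.+1 = p%:R ^+ n * t n + S n by rewrite addrC /S big_ord_recr.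
  rewrite -[X in eq_below _ _ (wcoef X)]add0r.
  by apply: eq_belowDr; apply/witt_pX_dvd; exists (t n).
have SD m n : eq_below m (S (m + n)%N) (S m).
  elim: n => [|n IHn] i lt_im; first by rewrite addn0.
  by rewrite addnS SS ?IHn // (leq_trans lt_im) ?leq_addr.
(* Coordinate [n] of the partial sums is constant from [S n.+1] on, hence the shifted index. *)
exists (Witt p_pr (fun n => S n.+1 n)) => n; set s := Witt _ _.
have /eq_below_sub/witt_pX_dvd[y def_y] : eq_below n s (S n).
  by move=> i lt_in; rewrite /= -(subnKC lt_in) SD.
by exists y; rewrite -def_y addrC subrK.
Qed.

Lemma wcoef0_surj (b : B) : exists x : W, wcoef0 x = b.
Proof. by exists (Witt p_pr (fun=> b)). Qed.

End PerfectWitt.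

(** * Passage from [R] through [B] to the Witt vectors *)

Lemma torsion_free_inj (R B : idomainType) (f : {rmorphism R -> B}) :
  torsion_free f -> injective f.
Proof.
move=> f_tf x y /eqP; rewrite -subr_eq0 -rmorphB -[f _]mulr1.
move=> /eqP/f_tf[/eqP|/eqP].
  by rewrite subr_eq0 => /eqP.
by rewrite oner_eq0.
Qed.

Theorem mainTheorem1 (p : nat) (p_pr : prime p) (R B : idomainType)
    (f : {rmorphism R -> B})
    (R_noetherian : noetherian R)
    (R_normal : integrally_closed R)
    (R_char : p \in [pchar R])
    (B_char : p \in [pchar B])
    (B_perfect : perfect p B)
    (B_closed : integrally_closed B)
    (B_torsion_free : torsion_free f)
    (B_integral : integralRange f) :
  integrally_closed_domain (witt p_pr B).
Proof.
have cicB : completely_integrally_closed B.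
  apply: (cic_integral_extension (f := f)) => //; first exact: torsion_free_inj.
  exact: noetherian_cic.
pose dom := domain_of_principal_kernel (@witt_p_reg p p_pr B B_char)
  (@witt_ker_wcoef0 p p_pr B B_char B_perfect)
  (@witt_p_separated p p_pr B B_char B_perfect).
exists dom; apply: cic_integrally_closed.
apply: (@cic_adically_complete (domain_of dom) B (@wcoef0 p p_pr B) p%:R) => //.
- exact: wcoef0_p.
(* If [p] were zero in the Witt vectors, its regularity would force [1 = 0]. *)
- apply/eqP => p0; have /eqP := oner_neq0 (domain_of dom); apply.
  by apply: (@witt_p_reg p p_pr B B_char); rewrite p0 mul0r.
- exact: witt_ker_wcoef0.
- exact: witt_p_separated.
- exact: wcoef0_surj.
- exact: witt_p_complete.
Qed.
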